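(* Let $\mathcal{M}_0$ be an abelian von Neumann algebra with unity $1$, and let $A, B \in M_2(\mathcal{M}_0)$ with $0 \le A \le I_2$ and $0 \le B \le I_2$ be such that $$A = \left((1 - x_0) \otimes I_2 \right) P_0 + (x_0 \otimes I_2) P$$ and $$B = \left((1 - x_0) \otimes I_2 \right) P_0 + (x_0 \otimes I_2) P'$$ for some strict element $x_0 \in \mathcal{M}_0^+$ and some strict projection $P$ in $M_2(\mathcal{M}_0)$, where $I_2 = \begin{bmatrix} 1 & 0 \\ 0 & 1 \end{bmatrix}$ is the unity of $M_2(\mathcal{M}_0)$, $P_0 = \begin{bmatrix} 0 & 0 \\ 0 & 1 \end{bmatrix}$ and $P' = I_2 - P$. Then $A$ and $B$ are strict elements of $M_2(\mathcal{M}_0)^+$ and $A$ is absolutely compatible with $B$.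
   Context: For a von Neumann algebra $\mathcal{N}$ with unity $1_{\mathcal{N}}$, $\mathcal{P}(\mathcal{N})$ denotes its set of projections. For $a \in \mathcal{N}$ with $0 \le a \le 1_{\mathcal{N}}$ put $s(a) := \sup\{q \in \mathcal{P}(\mathcal{N}) : q \le a\}$ and $n(a) := \sup\{q \in \mathcal{P}(\mathcal{N}) : q a = 0\}$; $a$ is called strict in $\mathcal{N}$ if $s(a) = 0$ and $n(a) = 0$. Elements $0 \le a, b \le 1_{\mathcal{N}}$ are absolutely compatible if $|a - b| + |1_{\mathcal{N}} - a - b| = 1_{\mathcal{N}}$, where $|x| = (x^*x)^{1/2}$. $M_2(\mathcal{M}_0)$ is the von Neumann algebra of $2\times 2$ matrices over $\mathcal{M}_0$, and $x \otimes I_2 = \begin{bmatrix} x & 0 \\ 0 & x \end{bmatrix}$ for $x \in \mathcal{M}_0$. For $\mathcal{M}_0$ abelian, a projection $P = \begin{bmatrix} p_1 & p \\ p^* & p_2 \end{bmatrix} \in M_2(\mathcal{M}_0)$ is a strict projection if $p_1$ is strict in $\mathcal{M}_0$ (with $p_1 \in \mathcal{M}_0^+$) and $p_1 + p_2 = 1$. *)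

(* Defs.v *)
From HB Require Import structures.
From mathcomp Require Import all_boot all_order all_algebra.
From mathcomp Require Import all_classical all_reals all_analysis complex.

Set Implicit Arguments.
Unset Strict Implicit.
Unset Printing Implicit Defensive.

Import Order.TTheory GRing.Theory Num.Theory.
Import numFieldNormedType.Exports.

Local Open Scope classical_set_scope.
Local Open Scope ring_scope.

Record bop (R : realType) (H : completeNormedModType R[i]) := Bop {
  bop_fun :> H -> H;
  bop_linear : linear bop_fun;
  bop_continuous : continuous bop_fun }.

Section BopRing.
Variables (R : realType) (H : completeNormedModType R[i]).
Implicit Types a b c : bop H.

Lemma bopP a b : a =1 b -> a = b.
Proof.
case: a b => [f fl fc] [g gl gc] /= /funext fg; case: g / fg gl gc => gl gc.
by rewrite (Prop_irrelevance gl fl) (Prop_irrelevance gc fc).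
Qed.

HB.instance Definition _ := gen_eqMixin (bop H).
HB.instance Definition _ := gen_choiceMixin (bop H).

Fact bop0_linear : linear (fun _ : H => 0 : H).
Proof. by move=> k x y; rewrite scaler0 addr0. Qed.
Fact bop0_continuous : continuous (fun _ : H => 0 : H).
Proof. by move=> x; exact: cvg_cst. Qed.
Definition bop0 := Bop bop0_linear bop0_continuous.

Fact bopN_linear a : linear (fun x => - a x).
Proof. by move=> k x y; rewrite bop_linear opprD scalerN. Qed.
Fact bopN_continuous a : continuous (fun x => - a x).
Proof. by move=> x; apply: cvgN; exact: bop_continuous. Qed.
Definition bopN a := Bop (bopN_linear a) (@bopN_continuous a).

Fact bopD_linear a b : linear (fun x => a x + b x).
Proof. by move=> k x y; rewrite !bop_linear scalerDr addrACA. Qed.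
Fact bopD_continuous a b : continuous (fun x => a x + b x).
Proof. by move=> x; apply: cvgD; exact: bop_continuous. Qed.
Definition bopD a b := Bop (bopD_linear a b) (@bopD_continuous a b).

Fact bop1_linear : linear (fun x : H => x).
Proof. by []. Qed.
Fact bop1_continuous : continuous (fun x : H => x).
Proof. by move=> x; exact: cvg_id. Qed.
Definition bop1 := Bop bop1_linear bop1_continuous.

Fact bopM_linear a b : linear (fun x => a (b x)).
Proof. by move=> k x y; rewrite !bop_linear. Qed.
Fact bopM_continuous a b : continuous (fun x => a (b x)).
Proof.
by move=> x; apply: (@continuous_comp _ _ _ b a x); exact: bop_continuous.
Qed.
Definition bopM a b := Bop (bopM_linear a b) (@bopM_continuous a b).

Fact bopDA : associative bopD.
Proof. by move=> a b c; apply: bopP => x; exact: addrA. Qed.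
Fact bopDC : commutative bopD.
Proof. by move=> a b; apply: bopP => x; exact: addrC. Qed.
Fact bop0D : left_id bop0 bopD.
Proof. by move=> a; apply: bopP => x; exact: add0r. Qed.
Fact bopND : left_inverse bop0 bopN bopD.
Proof. by move=> a; apply: bopP => x; exact: addNr. Qed.

HB.instance Definition _ :=
  GRing.isZmodule.Build (bop H) bopDA bopDC bop0D bopND.

Fact bopMA : associative bopM.
Proof. by move=> a b c; apply: bopP. Qed.
Fact bop1M : left_id bop1 bopM.
Proof. by move=> a; apply: bopP. Qed.
Fact bopM1 : right_id bop1 bopM.
Proof. by move=> a; apply: bopP. Qed.
Fact bopMDl : left_distributive bopM bopD.
Proof. by move=> a b c; apply: bopP. Qed.
Fact bopMDr : right_distributive bopM bopD.
Proof.
move=> a b c; apply: bopP => x /=.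
by have := bop_linear a 1 (b x) (c x); rewrite !scale1r.
Qed.

HB.instance Definition _ :=
  GRing.Zmodule_isPzRing.Build (bop H) bopMA bop1M bopM1 bopMDl bopMDr.

End BopRing.

Section VonNeumann.
Variables (R : realType) (H : completeNormedModType R[i]).

(* [dot] is linear in its first argument and conjugate-linear in the second;
   with this compatibility [H] is a complex Hilbert space. *)
Definition norm_of_dot (dot : {dot H for @Num.conj R[i]}) : Prop :=
  forall x : H, `|x| ^+ 2 = dot x x.

Variable dot : {dot H for @Num.conj R[i]}.

(* The adjoint exists and is unique when [H] is a Hilbert space, by the Riesz
   representation theorem, so the default value 0 is not used there. *)
Definition adjoint (a : bop H) : bop H :=
  xget 0 [set b : bop H | forall x y : H, dot (a x) y = dot x (b y)].

Definition commutant (S : set (bop H)) : set (bop H) :=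
  [set a | forall b, S b -> a * b = b * a].

(* Double commutant definition; it makes [M] a weakly closed subalgebra
   containing the identity operator. *)
Definition von_neumann_algebra (M : set (bop H)) : Prop :=
  (forall a, M a -> M (adjoint a)) /\ commutant (commutant M) = M.

End VonNeumann.

Definition abelian_algebra (A : pzRingType) (N : set A) : Prop :=
  forall a b, N a -> N b -> a * b = b * a.

Section StarAlgebra.
(* Meant for a von Neumann algebra [N], given as a unital *-subalgebra of a ring
   [A] with involution [star]: below, [A] is B(H) or M_2(B(H)), and [N] is M_0
   or M_2(M_0). *)
Variables (A : pzRingType) (star : A -> A) (N : set A).

(* The intrinsic C*-algebraic positive cone { b^* b : b in N }. *)
Definition positive (a : A) : Prop := exists2 b, N b & a = star b * b.

Definition le_in (a b : A) : Prop := positive (b - a).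

Definition unit_interval (a : A) : Prop :=
  [/\ N a, le_in 0 a & le_in a 1].

Definition projections : set A :=
  [set q | [/\ N q, star q = q & q * q = q]].

Definition is_proj_sup (S : set A) (p : A) : Prop :=
  [/\ projections p, (forall q, S q -> le_in q p) &
      forall r, projections r -> (forall q, S q -> le_in q r) -> le_in p r].

(* Suprema of projections exist and are unique in a von Neumann algebra; the
   default value is 1, so that having supremum 0 is never an artefact of it. *)
Definition proj_sup (S : set A) : A := xget 1 [set p | is_proj_sup S p].

(* s(a) *)
Definition support_one (a : A) : A :=
  proj_sup [set q | projections q /\ le_in q a].

(* n(a) *)
Definition null_proj (a : A) : A :=
  proj_sup [set q | projections q /\ q * a = 0].

Definition strict (a : A) : Prop :=
  [/\ unit_interval a, support_one a = 0 & null_proj a = 0].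

(* In a von Neumann algebra the positive square root of [star x * x] exists and
   is unique. *)
Definition abs_val (x : A) : A :=
  xget 0 [set y | positive y /\ y * y = star x * x].

Definition absolutely_compatible (a b : A) : Prop :=
  [/\ unit_interval a, unit_interval b &
      abs_val (a - b) + abs_val (1 - a - b) = 1].

End StarAlgebra.

Section Matrices.
Variable A : pzRingType.

Definition mx_star (star : A -> A) (X : 'M[A]_2) : 'M[A]_2 :=
  \matrix_(i, j) star (X j i).

Definition mx_algebra (N : set A) : set 'M[A]_2 :=
  [set X | forall i j, N (X i j)].

Definition strict_projection (star : A -> A) (N : set A) (P : 'M[A]_2) : Prop :=
  [/\ projections (mx_star star) (mx_algebra N) P,
      strict star N (P 0 0) & P 0 0 + P 1 1 = 1].

End Matrices.

(* Main.v *)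
Require Import Defs.
From HB Require Import structures.
From mathcomp Require Import all_boot all_order all_algebra.
From mathcomp Require Import all_classical all_reals all_analysis complex.
From mathcomp Require Import ring.
Import Order.TTheory GRing.Theory Num.Theory.
Import numFieldNormedType.Exports.

(** Write x for x_0 and D for the matrix unit P_0. Both assertions reduce to
    algebra in M_2(M_0), once strictness has been turned into injectivity.

    Strictness. For a in a von Neumann algebra, the projection onto ker a lies
    in the algebra: an operator of the commutant preserves ker a, and so does
    its adjoint, hence both commute with that projection. So when a is strict,
    a e = 0 forces e = 0 for the projection e onto ker a, and the same argument
    with 1 - a (where a e = e means that e <= a) applies: a and 1 - a are
    injective ([strict_lreg]). Conversely, an element a of the unit interval of
    a *-algebra such that a and 1 - a can be cancelled on the left is strict
    ([strict_of_lreg]), since a projection q with q a = 0 or q <= a satisfies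
    a q = 0 or (1 - a) q = 0. It remains to see that (1 - x) D + x P and its
    complement (1 - x)(1 - D) + x (1 - P) are left cancellable when x, 1 - x
    and the corner p_1 of P are ([lreg_pencil], [lreg_compl_pencil]). If the
    first one kills Q, put W = P Q: the upper row of the equation gives that
    the upper row of W vanishes, then P W = W and p_2 = 1 - p_1 kill its lower
    row, and W = 0 leaves Q = 0. For B the same lemmas apply to 1 - P, whose
    corner is 1 - p_1, which is injective as p_1 is strict.

    Absolute compatibility. A - B = x (2 P - 1) and
    1 - A - B = (1 - x)(1 - 2 D) are products of a positive element, which is
    central because M_0 is abelian, and of a self-adjoint unitary. The absolute
    value of such a product is its positive factor
    ([abs_val_central_mul_symmetry]), so the two absolute values are x and
    1 - x, and they add up to 1. Uniqueness of the square root is elementary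
    here because one of the two candidates is central ([abs_val_unique]).

    Adjoints of bounded operators and projections onto closed subspaces both
    come from the Riesz representation theorem relative to a closed subspace
    ([riesz_on_subspace], [adjoint_into]). *)

Set Implicit Arguments.
Unset Strict Implicit.
Unset Printing Implicit Defensive.

Local Open Scope classical_set_scope.
Local Open Scope ring_scope.

(** * The Riesz representation theorem on a closed subspace *)

(** The order of the complex numbers is partial, but a set that is bounded
    below lies on one horizontal line, where it is a translate of the order of
    the reals. Infima taken there let the minimisation below stay among the
    complex numbers, which is where the norm of a complex normed module takes
    its values. *)
Lemma complex_inf (R : realType) (E : set R[i]) (b : R[i]) :
  E !=set0 -> (forall x, E x -> b <= x) ->
  exists m : R[i], (forall x, E x -> m <= x) /\
    (forall e, 0 < e -> exists2 x, E x & x < m + e).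
Proof.
move=> [x0 Ex0] lbE; pose F : set R := [set complex.Re x | x in E].
have ImE x : E x -> complex.Im x = complex.Im b.
  by move=> /lbE; rewrite lecE => /andP[/eqP ->].
have hinf : has_inf F.
  split; first by exists (complex.Re x0), x0.
  by exists (complex.Re b) => _ [x Ex <-]; move: (lbE _ Ex); rewrite lecE => /andP[].
exists (Complex (inf F) (complex.Im b)); split.
  move=> x Ex; rewrite lecE /= ImE // eqxx /=.
  by apply: ge_inf; [exact: hinf.2 | exists x].
move=> [e i]; rewrite ltcE /= => /andP[/eqP -> e0].
have [_ [x Ex <-] lt_x] := inf_adherent e0 hinf.
by exists x => //; rewrite ltcE /= addr0 ImE // eqxx.
Qed.

Section Hilbert.
Variables (R : realType) (H : completeNormedModType R[i]).
Variable dot : {dot H for @Num.conj R[i]}.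
Hypothesis hdot : norm_of_dot dot.
Local Notation C := (R[i]).
Implicit Types (x y z u v : H).

Lemma dotC x y : dot x y = (dot y x)^*.
Proof. by rewrite hermC /= expr0 mul1r. Qed.

Lemma norm_sub_dot_sq x y :
  `|x - y| ^+ 2 = `|x| ^+ 2 + `|y| ^+ 2 - (dot x y + (dot x y)^* ).
Proof. by rewrite !hdot; have /= -> := dnormB dot x y. Qed.

Lemma norm_add_dot_sq x y :
  `|x + y| ^+ 2 = `|x| ^+ 2 + `|y| ^+ 2 + (dot x y + (dot x y)^* ).
Proof. by rewrite !hdot; have /= -> := dnormD dot x y. Qed.

Lemma parallelogram x y :
  `|x + y| ^+ 2 + `|x - y| ^+ 2 = 2 * (`|x| ^+ 2 + `|y| ^+ 2).
Proof.
by rewrite norm_add_dot_sq norm_sub_dot_sq addrACA subrr addr0 mulr2n mulrDl !mul1r.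
Qed.

(** The squared norm of [x - c y] is nonnegative for the coefficient [c] that
    makes [x - c y] orthogonal to [y]. *)
Lemma cauchy_schwarz x y : `|dot x y| <= `|x| * `|y|.
Proof.
have [->|y0] := eqVneq y 0; first by rewrite linear0r normr0 mulr_ge0.
have ny : 0 < `|y| by rewrite normr_gt0.
rewrite -(@ler_pXn2r _ 2) ?nnegrE ?mulr_ge0 // exprMn.
pose c := dot x y / `|y| ^+ 2.
have := exprn_ge0 2 (normr_ge0 (x - c *: y)).
rewrite norm_sub_dot_sq normrZ linearZr_LR /=.
rewrite exprMn.
have -> : `|c| ^+ 2 * `|y| ^+ 2 = `|dot x y| ^+ 2 / `|y| ^+ 2.
  rewrite /c normrM normrV ?unitfE ?expf_neq0 ?normr_eq0 // normrX normr_id.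
  by field; rewrite normr_eq0.
have -> : c^* * dot x y = `|dot x y| ^+ 2 / `|y| ^+ 2.
  rewrite /c rmorphM fmorphV rmorphXn /= (conj_Creal (normr_real y)).
  by rewrite mulrAC [_ ^* * _]mulrC -normCK.
rewrite rmorphM fmorphV !rmorphXn /= (conj_Creal (normr_real y)).
rewrite (conj_Creal (normr_real (dot x y))) opprD addrA addrK subr_ge0.
by rewrite ler_pdivrMr ?exprn_gt0.
Qed.

Lemma dot_sub_eq x y : dot (x - y) x = dot (x - y) y -> x = y.
Proof.
move=> e; apply/eqP; rewrite -subr_eq0 -normr_eq0; have := hdot (x - y).
by rewrite linearBr /= e subrr => /eqP; rewrite expf_eq0.
Qed.

Definition closed_subspace (K : set H) : Prop :=
  [/\ closed K, K 0 & forall c x y, K x -> K y -> K (c *: x + y)].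

Section Riesz.
Variables (K : set H) (hK : closed_subspace K) (f : {scalar H}) (M : C).
Hypothesis M0 : 0 <= M.
Hypothesis fM : forall z, `|f z| <= M * `|z|.

Let fZ c z : f (c *: z) = c * f z. Proof. exact: linearZ. Qed.
Let fD x y : f (x + y) = f x + f y. Proof. exact: linearD. Qed.

(** Completing the square, [J z] is the squared distance from [z] to the vector
    that represents [f], up to a constant: that vector is found as a
    minimiser of [J] on [K]. *)
Let J z := `|z| ^+ 2 - (f z + (f z)^*).

Lemma add_conj_le (c : C) : c + c^* <= 2 * `|c|.
Proof.
have /leifP := leif_Re_Creal c.
rewrite ReE => h.
have : (c + c^*) / 2%:R <= `|c| by case: ifP h => _; [move/eqP-> | move/ltW].
by rewrite ler_pdivrMr // mulrC.
Qed.

Lemma J_lower_bound z : - (M ^+ 2) <= J z.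
Proof.
have : f z + (f z)^* <= 2 * (M * `|z|).
  by apply: le_trans (add_conj_le _) _; rewrite ler_pM2l.
rewrite -subr_ge0 => le_f; rewrite -subr_ge0.
have sq_ge0 : 0 <= (`|z| - M) ^+ 2 by rewrite real_exprn_even_ge0 // rpredB ?ger0_real.
suff -> : J z - - M ^+ 2 =
    (`|z| - M) ^+ 2 + (2 * (M * `|z|) - (f z + (f z)^*)) by rewrite addr_ge0.
by rewrite /J; ring.
Qed.

(** Parallelogram law: two points of [K] at which [J] is close to its infimum
    are close to each other, because [J] cannot be smaller at their midpoint. *)
Lemma J_midpoint x y : K x -> K y ->
  exists2 z, K z & `|x - y| ^+ 2 = 2 * (J x + J y) - 4 * J z.
Proof.
case: hK => _ K0 Klin Kx Ky; exists (2^-1 *: (x + y)).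
  have := Klin 2^-1 (x + y) 0; rewrite addr0; apply => //.
  by rewrite -[x]scale1r; apply: Klin.
have -> : `|x - y| ^+ 2 = 2 * (`|x| ^+ 2 + `|y| ^+ 2) - `|x + y| ^+ 2.
  by rewrite -parallelogram addrAC subrr add0r.
have -> : J (2^-1 *: (x + y)) = 4^-1 * `|x + y| ^+ 2
    - 2^-1 * ((f x + (f x)^*) + (f y + (f y)^*)).
  rewrite /J normrZ exprMn ger0_norm ?invr_ge0 // fZ fD rmorphM fmorphV rmorph_nat.
  by rewrite rmorphD; field.
by rewrite /J; field.
Qed.

(** How much [J] can be lowered by moving along [z]: at a near minimiser this
    bounds the defect [dot z u - f z]. *)
Lemma J_shift u z : z != 0 -> exists c : C,
  J (u + c *: z) = J u - `|dot z u - f z| ^+ 2 / `|z| ^+ 2.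
Proof.
move=> z0; have [w wE] : exists w, w = dot z u - f z by exists (dot z u - f z).
have [c cE cJ] : exists2 c : C, c = - w^* / `|z| ^+ 2 & c^* = - w / `|z| ^+ 2.
  (* The minimiser of the quadratic function [c |-> J (u + c *: z)]. *)
  exists (- w^* / `|z| ^+ 2) => //.
  by rewrite rmorphM rmorphN fmorphV rmorphXn /= conjCK (conj_Creal (normr_real z)).
exists c; rewrite /J norm_add_dot_sq normrZ linearZr_LR fD fZ /= -wE.
have -> : dot u z = w^* + (f z)^* by rewrite dotC -rmorphD wE subrK.
have -> : f z = dot z u - w by rewrite wE subKr.
rewrite [(`|c| * `|z|) ^+ 2]exprMn [`|c| ^+ 2]normCK [`|w| ^+ 2]normCK.
rewrite !(rmorphD, rmorphM, rmorphB) /= !conjCK cJ cE.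
by field; rewrite normr_eq0.
Qed.

(** The near minimisers of [J] on [K] form a Cauchy filter by [J_midpoint]; by
    [J_shift], its limit represents [f] on [K]. With [K] the whole space this
    is the usual Riesz theorem, and for [f] of the form [dot _ v] it gives the
    orthogonal projection of [v] on [K]. *)
Lemma riesz_on_subspace :
  exists2 u, K u & forall z, K z -> f z = dot z u.
Proof.
case: hK => Kcl K0 Klin.
have [||m [lbm infm]] := @complex_inf R (J @` K) (- (M ^+ 2)).
- by exists (J 0), 0.
- by move=> _ [z _ <-]; exact: J_lower_bound.
pose B (e : C) := [set z | K z /\ J z < m + e].
pose F := filter_from [set e : C | 0 < e] B.
have FF : ProperFilter F.
  apply: filter_from_proper; last first.
    by move=> e /= /infm[_ [z Kz <-] ?]; exists z.
  apply: filter_from_filter; first by exists 1 => /=.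
  move=> e1 e2 /= e10 e20.
  wlog le12 : e1 e2 e10 e20 / e1 <= e2.
    move=> W; have /orP[|] := real_leVge (gtr0_real e10) (gtr0_real e20).
      exact: W.
    by move=> /(W _ _ e20 e10) [e e0 sub]; exists e => // z /sub[].
  exists e1 => // z [Kz Jz]; split; split => //.
  by apply: lt_le_trans Jz _; rewrite lerD2l.
have near_min e x : 0 < e -> K x -> J x < m + e ^+ 2 ->
    forall z, K z -> `|dot z x - f z| <= e * `|z|.
  move=> e0 Kx Jx z Kz; have [->|z0] := eqVneq z 0.
    by rewrite linear0l /= raddf0 subrr !normr0 mulr0.
  have [c Jc] := J_shift x z0.
  have : m <= J (x + c *: z).
    by apply: lbm; exists (x + c *: z) => //; rewrite addrC; exact: Klin.
  rewrite Jc lerBrDr -lerBrDl => le1.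
  have : `|dot z x - f z| ^+ 2 / `|z| ^+ 2 <= e ^+ 2.
    by apply: le_trans le1 _; rewrite lerBlDl ltW.
  rewrite ler_pdivrMr ?exprn_gt0 ?normr_gt0 // -exprMn.
  by rewrite ler_pXn2r // nnegrE mulr_ge0 // ltW.
have : cauchy F.
  apply: cauchy_exP => e e0.
  have e20 : 0 < (e / 2) ^+ 2 by rewrite exprn_gt0 // divr_gt0.
  have [_ [x Kx <-] Jx] := infm _ e20.
  exists x; exists ((e / 2) ^+ 2) => // y [Ky Jy].
  rewrite -ball_normE /=.
  rewrite -(@ltr_pXn2r _ 2) ?nnegrE ?(ltW e0) //.
  have [z Kz ->] := J_midpoint Kx Ky.
  have le_z : m <= J z by apply: lbm; exists z.
  rewrite ltrBlDr.
  apply: (@lt_le_trans _ _ (2 * (m + (e / 2) ^+ 2 + (m + (e / 2) ^+ 2)))).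
    by rewrite ltr_pM2l // ltrD.
  have -> : 2 * (m + (e / 2) ^+ 2 + (m + (e / 2) ^+ 2)) = e ^+ 2 + 4 * m by field.
  by rewrite lerD2l ler_pM2l.
move=> /cauchy_cvgP/cvg_ex[u Fu].
have near_u e : 0 < e -> exists x, [/\ K x, J x < m + e ^+ 2 & `|u - x| < e].
  move=> e0; have e20 : 0 < e ^+ 2 by rewrite exprn_gt0.
  have FB : F (B (e ^+ 2)) by exists (e ^+ 2).
  have Fe : F (ball u e) by apply: Fu; exact: nbhsx_ballx.
  have [x [[Kx Jx] ux]] := filter_ex (filterI FB Fe).
  by exists x; split=> //; move: ux; rewrite -ball_normE.
exists u.
  apply: Kcl => A; rewrite -nbhs_ballE => -[e /= e0 eA].
  have [x [Kx _ ux]] := near_u _ e0.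
  by exists x; split => //; apply: eA; rewrite -ball_normE.
move=> z Kz; apply/esym/eqP; rewrite -subr_eq0 -normr_le0.
apply/ler_addgt0Pr => e e0; rewrite add0r.
have [->|z0] := eqVneq z 0.
  by rewrite linear0l /= raddf0 subrr normr0 ltW.
pose d := e / (2 * `|z|).
have d0 : 0 < d by rewrite divr_gt0 // mulr_gt0 // normr_gt0.
have [x [Kx Jx ux]] := near_u _ d0.
have -> : dot z u - f z = dot z (u - x) + (dot z x - f z).
  by rewrite linearBr /= addrA subrK.
apply: le_trans (ler_normD _ _) _.
have -> : e = `|z| * d + d * `|z| by rewrite /d; field; rewrite normr_eq0.
apply: lerD; last exact: near_min.
by apply: le_trans (cauchy_schwarz _ _) _; rewrite ler_wpM2l // ltW.
Qed.

End Riesz.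
End Hilbert.

(** * Adjoints and projections onto kernels *)

Section Bop.
Variables (R : realType) (H : completeNormedModType R[i]).
Implicit Types a : bop H.

Lemma bop_subr a x y : a (x - y) = a x - a y.
Proof. by rewrite addrC -scaleN1r bop_linear scaleN1r addrC. Qed.

Lemma bop_0 a : a 0 = 0.
Proof. by rewrite -[0 in LHS](subrr 0) bop_subr subrr. Qed.

Lemma bop_norm_le a : exists2 M : R[i], 0 <= M & forall x, `|a x| <= M * `|x|.
Proof.
pose L : {linear H -> H} :=
  HB.pack (bop_fun a) (GRing.isLinear.Build _ _ _ _ (bop_fun a) (bop_linear a)).
have /linear_bounded_continuous/linear_boundedP/pinfty_ex_gt0[M M0 aM] :
  continuous L by exact: bop_continuous.
by exists M => //; exact: ltW.
Qed.

End Bop.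

Section Adjoint.
Variables (R : realType) (H : completeNormedModType R[i]).
Variable dot : {dot H for @Num.conj R[i]}.
Hypothesis hdot : norm_of_dot dot.
Implicit Types (a b : bop H) (x y z u v : H).
Local Notation adj := (adjoint dot).

Lemma closed_subspaceT : closed_subspace [set: H].
Proof. by split => //; exact: closedT. Qed.

(** [g] is the adjoint of the restriction of [a] to [K]. It is the adjoint of
    [a] when [K] is the whole space, and the orthogonal projection on [K] when
    [a] is the identity. *)
Lemma adjoint_into (K : set H) (a : bop H) : closed_subspace K ->
  exists g : bop H, (forall y, K (g y)) /\
    forall y z, K z -> dot (a z) y = dot z (g y).
Proof.
move=> hK; have [M M0 aM] := bop_norm_le a.
have rep y : exists u, K u /\ forall z, K z -> dot (a z) y = dot z u.
  have flin : linear_for *%R (fun z => dot (a z) y).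
    by move=> c z w; rewrite bop_linear linearPl.
  pose f : {scalar H} := HB.pack (fun z => dot (a z) y)
    (GRing.isLinear.Build _ _ _ _ (fun z => dot (a z) y) flin).
  have fM z : `|f z| <= (M * `|y|) * `|z|.
    apply: le_trans (cauchy_schwarz hdot _ _) _.
    by rewrite mulrAC ler_wpM2r.
  have [u Ku fu] := riesz_on_subspace hdot hK (mulr_ge0 M0 (normr_ge0 y)) fM.
  by exists u.
have [g gP] := choice rep.
have Kg y : K (g y) by case: (gP y).
have gE y z : K z -> dot (a z) y = dot z (g y) by case: (gP y) => _; exact.
case: (hK) => Kcl K0 Klin.
have KB x y : K x -> K y -> K (x - y).
  by move=> Kx Ky; rewrite addrC -scaleN1r; exact: Klin.
have K_inj x y : K x -> K y -> (forall z, K z -> dot z x = dot z y) -> x = y.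
  by move=> Kx Ky e; apply: (dot_sub_eq hdot); apply: e; exact: KB.
have glin : linear g.
  move=> c x y; apply: K_inj => [//||z Kz]; first exact: Klin.
  by rewrite -gE // !linearPr /= !gE.
have gM y : `|g y| <= M * `|y|.
  have [->|gy0] := eqVneq (g y) 0; first by rewrite normr0 mulr_ge0.
  rewrite -(ler_pM2r (x := `|g y|)) ?normr_gt0 // -expr2 hdot -gE //.
  rewrite -[dot _ _]ger0_norm; last by rewrite gE // -hdot exprn_ge0.
  apply: le_trans (cauchy_schwarz hdot _ _) _.
  by rewrite mulrAC ler_wpM2r.
pose L : {linear H -> H} :=
  HB.pack g (GRing.isLinear.Build _ _ _ _ g glin).
have gcont : continuous L.
  apply/linear_bounded_continuous/linear_boundedP.
  exists M; split; first exact: ger0_real.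
  by move=> r Mr x; apply: le_trans (gM x) _; rewrite ler_wpM2r // ltW.
by exists (Bop glin gcont).
Qed.

Lemma adjointP a x y : dot (a x) y = dot x (adj a y).
Proof.
rewrite /adjoint; case: xgetP => [b _ -> //|no].
have [g [_ gE]] := adjoint_into a closed_subspaceT.
by case: (no g) => x' y'; rewrite gE.
Qed.

Lemma adjoint_unique a b : (forall x y, dot (a x) y = dot x (b y)) -> adj a = b.
Proof.
by move=> e; apply: bopP => y; apply: (dot_sub_eq hdot); rewrite -adjointP e.
Qed.

Lemma adjointPr a x y : dot x (a y) = dot (adj a x) y.
Proof. by rewrite dotC adjointP -dotC. Qed.

Lemma adjointK : involutive adj.
Proof. by move=> a; apply: adjoint_unique => x y; rewrite -adjointPr. Qed.

Lemma adjointB a b : adj (a - b) = adj a - adj b.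
Proof.
apply: adjoint_unique => x y.
by rewrite linearBl linearBr /= !adjointP.
Qed.

Lemma adjointM a b : adj (a * b) = adj b * adj a.
Proof. by apply: adjoint_unique => x y /=; rewrite !adjointP. Qed.

Lemma bop_sum (I : finType) (f : I -> bop H) x : (\sum_i f i) x = \sum_i f i x.
Proof. exact: (big_morph (fun a : bop H => a x)). Qed.

(** The sum applied to [x] and paired with [x] is the sum of the squared norms
    of the [f i x]. *)
Lemma adjoint_proper (I : finType) (f : I -> bop H) :
  \sum_i adj (f i) * f i = 0 -> forall i, f i = 0.
Proof.
move=> f0 i; apply: bopP => x /=.
have : \sum_j `|f j x| ^+ 2 = 0.
  have -> : \sum_j `|f j x| ^+ 2 = dot x ((\sum_j adj (f j) * f j) x).
    by rewrite bop_sum linear_sumr /=; apply: eq_bigr => j _; rewrite hdot adjointP.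
  by rewrite f0 linear0r.
move=> /eqP; rewrite psumr_eq0 => [|j _]; last by rewrite exprn_ge0.
by move=> /allP/(_ i (mem_index_enum i)); rewrite expf_eq0 normr_eq0 => /eqP.
Qed.

Section KernelProjection.
Variables (M0 : set (bop H)) (hM0 : von_neumann_algebra dot M0).

Lemma commutant_adjoint b : commutant M0 b -> commutant M0 (adj b).
Proof.
move=> hb a Ma; have := hb _ (hM0.1 a Ma).
by move=> /(congr1 adj); rewrite !adjointM adjointK.
Qed.

Lemma ker_closed_subspace a : closed_subspace [set z | a z = 0].
Proof.
split => [| |c x y /= ax ay]; last 2 first.
- exact: bop_0.
- by rewrite bop_linear ax ay scaler0 addr0.
apply: (preimage_closed (f := bop_fun a) (D := [set 0])).
  by move=> x _; exact: bop_continuous.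
exact: (accessible_closed_set1 (hausdorff_accessible (@norm_hausdorff _ H))).
Qed.

(** By the double commutant condition, [e] has to commute with each [b] in the
    commutant of [M0]. As [b] commutes with [a] it preserves the kernel, that
    is [e b e = b e]; the same for the adjoint of [b] gives [e b e = e b]. *)
Lemma kernel_projection a : M0 a ->
  exists e, [/\ projections adj M0 e, a * e = 0 & forall x, a x = 0 -> e x = x].
Proof.
move=> Ma; have hK := ker_closed_subspace a.
have [e [Ke /= eE]] := adjoint_into (bop1 H) hK.
have efix x : a x = 0 -> e x = x.
  move=> ax; apply: (dot_sub_eq hdot); rewrite -eE //=.
  by rewrite bop_subr ax subr0; exact: Ke.
have ee : e * e = e by apply: bopP => x /=; apply: efix; exact: Ke.
have e_adj : adj e = e.
  apply: adjoint_unique => x y.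
  rewrite eE; last exact: Ke.
  by rewrite dotC -eE; [rewrite -dotC | exact: Ke].
exists e; split => //; last by apply: bopP => x; exact: Ke.
split => //; rewrite -hM0.2 => b hb.
have ebe c : commutant M0 c -> e * (c * e) = c * e.
  move=> hc; apply: bopP => x /=; apply: efix.
  have -> : a (c (e x)) = c (a (e x)).
    by have /(congr1 (fun d : bop H => d (e x))) := hc _ Ma.
  by rewrite Ke bop_0.
rewrite -(ebe b hb); have /(congr1 adj) := ebe _ (commutant_adjoint hb).
by rewrite !adjointM adjointK e_adj => <-; rewrite mulrA.
Qed.

End KernelProjection.
End Adjoint.

(** * Strictness and absolute values in a ring with proper involution *)

(** The condition on sums is stated for sums of any length, and not only for
    two terms, so that it passes to matrices, where a diagonal entry of
    [star X * X] is such a sum. For operators it expresses that a sum of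
    positive operators vanishes only if each of them does. *)
Record proper_involution (A : pzRingType) (star : A -> A) : Prop :=
  ProperInvolution {
    starB : {morph star : a b / a - b};
    starM : forall a b, star (a * b) = star b * star a;
    starK : involutive star;
    star_proper : forall (I : finType) (f : I -> A),
      \sum_i star (f i) * f i = 0 -> forall i, f i = 0 }.

Record star_subring (A : pzRingType) (star : A -> A) (N : set A) : Prop :=
  StarSubring {
    subring1 : N 1;
    subringB : forall a b, N a -> N b -> N (a - b);
    subringM : forall a b, N a -> N b -> N (a * b);
    subring_star : forall a, N a -> N (star a) }.

Lemma lreg_of_ker (A : pzRingType) (a : A) :
  (forall b, a * b = 0 -> b = 0) -> GRing.lreg a.
Proof.
move=> ha b c /eqP; rewrite -subr_eq0 -mulrBr => /eqP/ha/eqP.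
by rewrite subr_eq0 => /eqP.
Qed.

Section ProperStar.
Variables (A : pzRingType) (star : A -> A) (N : set A).
Hypotheses (hstar : proper_involution star) (hN : star_subring star N).
Implicit Types a b c p q y z s : A.

Lemma star0 : star 0 = 0.
Proof. by rewrite -[0 in LHS](subrr 0) (starB hstar) subrr. Qed.

Lemma star1 : star 1 = 1.
Proof. by have := starM hstar (star 1) 1; rewrite !(mulr1, starK hstar) => <-. Qed.

Lemma starN a : star (- a) = - star a.
Proof. by rewrite -sub0r (starB hstar) star0 sub0r. Qed.

Lemma starD a b : star (a + b) = star a + star b.
Proof. by rewrite -[b in LHS]opprK (starB hstar) starN opprK. Qed.

Lemma subring0 : N 0.
Proof. by rewrite -(subrr 1); apply: (subringB hN); exact: (subring1 hN). Qed.

Lemma subringD a b : N a -> N b -> N (a + b).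
Proof.
move=> Na Nb; rewrite -[b]opprK -[- b]sub0r.
by do 2!apply: (subringB hN) => //; exact: subring0.
Qed.

Lemma star_mul_eq0 a : star a * a = 0 -> a = 0.
Proof.
move=> a0; apply: (star_proper hstar (f := fun _ : unit => a) _ tt).
by rewrite big_const cardE enumT unlock /= a0 addr0.
Qed.

Lemma star_mulD_eq0 a b : star a * a + star b * b = 0 -> a = 0 /\ b = 0.
Proof.
move=> ab0; pose f (i : bool) := if i then a else b.
have f0 : forall i, f i = 0 by apply: (star_proper hstar); rewrite big_bool.
by split; [exact: (f0 true) | exact: (f0 false)].
Qed.

Lemma positive_star a : positive star N a -> star a = a.
Proof. by move=> [b _ ->]; rewrite (starM hstar) (starK hstar). Qed.

Lemma positive_projection p : projections star N p -> positive star N p.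
Proof. by move=> [Np p_sa pp]; exists p; rewrite // p_sa pp. Qed.

Lemma projection_le0 p : projections star N p -> le_in star N p 0 -> p = 0.
Proof.
move=> [_ p_sa pp] [b _]; rewrite sub0r => /eqP; rewrite eqr_oppLR -addr_eq0.
by rewrite -{1}pp -{1}p_sa => /eqP /star_mulD_eq0[].
Qed.

(** A supremum equal to 0 is either a genuine one, or the default value 1 of
    [proj_sup], in which case the ring is trivial. *)
Lemma proj_sup_eq0 (S : set A) :
  proj_sup star N S = 0 -> forall q, S q -> projections star N q -> q = 0.
Proof.
rewrite /proj_sup; case: xgetP => [p _ [_ ub _] p0 q Sq hq|_ one0 q _ _].
  by apply: projection_le0 => //; rewrite -p0; exact: ub.
by rewrite -[q]mulr1 one0 mulr0.
Qed.

Lemma proj_sup_trivial (S : set A) :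
  (forall q, S q -> q = 0) -> proj_sup star N S = 0.
Proof.
move=> S0; have proj0 : projections star N 0.
  by split; [exact: subring0 | exact: star0 | rewrite mulr0].
have le0S q : S q -> le_in star N q 0.
  move/S0 => ->; rewrite /le_in subr0; exact: positive_projection.
rewrite /proj_sup; case: xgetP => [p _ [hp _ least]|no].
  by apply: projection_le0 => //; exact: least.
case: (no 0); split => // r hr _.
by rewrite /le_in subr0; exact: positive_projection.
Qed.

(** Let [z] be another positive square root of [star x * x] and [d = z - y]. As
    [y] commutes with [z], [(z + y) * d = 0], so that the positive elements
    [d * z * d] and [d * y * d] have sum 0. Both vanish, and then so do
    [z * d], [y * d], and finally [d * d]. *)
Lemma abs_val_unique x y : positive star N y -> y * y = star x * x ->
  (forall z, N z -> y * z = z * y) -> abs_val star N x = y.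
Proof.
move=> y_pos yy yC; rewrite /abs_val; case: xgetP => [z _ [z_pos zz]|no]; last first.
  by case: (no y).
have [[c Nc yE] [b Nb zE]] := (y_pos, z_pos).
have Nz : N z by rewrite zE; apply: (subringM hN) => //; exact: (subring_star hN).
pose d := z - y; have d_sa : star d = d by rewrite (starB hstar) !positive_star.
have d0 : (z + y) * d = 0.
  by rewrite /d mulrDl !mulrBr zz yy (yC z Nz) addrA subrK subrr.
have [bd cd] : b * d = 0 /\ c * d = 0.
  apply: star_mulD_eq0; rewrite !(starM hstar) d_sa -!mulrA.
  by rewrite (mulrA (star b)) (mulrA (star c)) -zE -yE -mulrDr -mulrDl d0 mulr0.
have dd : d * d = 0.
  by rewrite {1}/d mulrBl {1}zE yE -!mulrA bd cd !mulr0 subrr.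
by apply/eqP; rewrite -subr_eq0 -/d; apply/eqP/star_mul_eq0; rewrite d_sa.
Qed.

Lemma abs_val_central_mul_symmetry x y s : positive star N y ->
  (forall z, N z -> y * z = z * y) -> N s -> star s = s -> s * s = 1 ->
  x = y * s -> abs_val star N x = y.
Proof.
move=> y_pos yC Ns s_sa ss ->; apply: abs_val_unique => //.
rewrite (starM hstar) s_sa (positive_star y_pos) mulrA -(yC s) // -(mulrA y s y).
by rewrite -(yC s) // -!mulrA ss mulr1.
Qed.

(** If [q <= a], then [q (1 - a) q] and [q (a - q) q] are positive and have
    sum [q (1 - q) q = 0], whence [(1 - a) q = 0]. *)
Lemma strict_of_lreg a : unit_interval star N a ->
  GRing.lreg a -> GRing.lreg (1 - a) -> strict star N a.
Proof.
move=> ha a_reg oma_reg; case: (ha) => Na [c Nc aE] [d Nd omaE].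
have a_sa : star a = a by apply: positive_star; exists c => //; rewrite -aE subr0.
have oma_sa : star (1 - a) = 1 - a by apply: positive_star; exists d.
split => //; apply: proj_sup_trivial => q [[Nq q_sa qq]].
  move=> [b _ qaE]; apply: oma_reg; rewrite mulr0.
  have [dq _] : d * q = 0 /\ b * q = 0.
    apply: star_mulD_eq0; rewrite !(starM hstar) q_sa -!mulrA.
    rewrite (mulrA (star d)) (mulrA (star b)) -omaE -qaE -mulrDr -mulrDl.
    by rewrite addrA subrK mulrBl mul1r mulrBr !qq subrr.
  by rewrite omaE -mulrA dq mulr0.
move=> qa; apply: a_reg.
by rewrite mulr0 -[LHS](starK hstar) (starM hstar) q_sa a_sa qa star0.
Qed.

Lemma projection_reflection p : projections star N p ->
  [/\ N (1 - p - p), star (1 - p - p) = 1 - p - p &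
      (1 - p - p) * (1 - p - p) = 1].
Proof.
move=> [Np p_sa pp]; split.
- by do 2!apply: (subringB hN) => //; exact: (subring1 hN).
- by rewrite !(starB hstar) star1 p_sa.
have p_perp : p * (1 - p - p) = - p by rewrite !mulrBr mulr1 pp subrr sub0r.
by rewrite [LHS]mulrBl mulrBl mul1r p_perp !opprK !subrK.
Qed.

Lemma projection_compl p : projections star N p -> projections star N (1 - p).
Proof.
move=> [Np p_sa pp]; split; first by apply: (subringB hN) => //; exact: (subring1 hN).
  by rewrite (starB hstar) star1 p_sa.
by rewrite mulrBl mul1r mulrBr mulr1 pp subrr subr0.
Qed.

(** If [a q = q], then [a - q] is the compression of [a] by [1 - q], hence
    [q <= a]. *)
Lemma strict_no_projection a q : strict star N a -> projections star N q ->
  (a * q = 0 -> q = 0) /\ (a * q = q -> q = 0).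
Proof.
move=> [[Na [c Nc aE] _] s0 n0] hq; case: (hq) => [Nq q_sa qq].
rewrite subr0 in aE.
have a_sa : star a = a by apply: positive_star; exists c.
have qaE b : a * q = b -> q * a = star b.
  by move=> <-; rewrite (starM hstar) q_sa a_sa.
split=> [/qaE|/[dup] aq /qaE]; rewrite ?star0 ?q_sa => qa.
  exact: (proj_sup_eq0 n0).
apply: (proj_sup_eq0 s0) => //; split => //.
exists (c * (1 - q)).
  apply: (subringM hN) => //; apply: (subringB hN) => //; exact: (subring1 hN).
rewrite (starM hstar) (starB hstar) star1 q_sa -mulrA (mulrA (star c)) -aE.
by rewrite mulrBr mulr1 aq mulrBl mul1r mulrBr qa qq subrr subr0.
Qed.

End ProperStar.

(** * Two-by-two matrices *)

Section Matrices.
Variables (A : pzRingType) (star : A -> A) (N : set A).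

Section StarSubring.
Hypotheses (hstar : proper_involution star) (hN : star_subring star N).

Lemma mx_star_proper_involution : proper_involution (mx_star star).
Proof.
split=> [X Y|X Y|X|I F F0 i].
- by apply/matrixP => i j; rewrite !mxE (starB hstar).
- apply/matrixP => i j; rewrite !mxE !big_ord_recl !big_ord0 !mxE !addr0.
  by rewrite (starD hstar) !(starM hstar).
- by apply/matrixP => i j; rewrite !mxE (starK hstar).
apply/matrixP => k j; rewrite mxE.
apply: (star_proper hstar (f := fun ik : I * 'I_2 => F ik.1 ik.2 j) _ (i, k)).
rewrite -(pair_bigA _ (fun i k => star (F i k j) * F i k j)) /=.
transitivity ((\sum_l mx_star star (F l) * F l) j j); last by rewrite F0 mxE.
rewrite summxE; apply: eq_bigr => l _.
by rewrite mxE; apply: eq_bigr => m _; rewrite mxE.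
Qed.

Lemma mx_algebra_scalar a : N a -> mx_algebra N a%:M.
Proof. by move=> Na i j; rewrite mxE; case: eqP => // _; exact: (subring0 hN). Qed.

Lemma mx_algebra_star_subring : star_subring (mx_star star) (mx_algebra N).
Proof.
split=> [|X Y NX NY i j|X Y NX NY i j|X NX i j].
- by apply: mx_algebra_scalar; exact: (subring1 hN).
- by rewrite !mxE; apply: (subringB hN).
- rewrite !mxE !big_ord_recl big_ord0 addr0.
  by apply: (subringD hN); apply: (subringM hN).
- by rewrite mxE; apply: (subring_star hN).
Qed.

Lemma mx_star_scalar a : mx_star star a%:M = (star a)%:M.
Proof.
by apply/matrixP => i j; rewrite !mxE eq_sym; case: eqP; rewrite ?(star0 hstar).
Qed.

Lemma mx_positive_scalar a : positive star N a ->
  positive (mx_star star) (mx_algebra N) a%:M.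
Proof.
move=> [b Nb ->]; exists b%:M; first exact: mx_algebra_scalar.
by rewrite mx_star_scalar -[RHS]scalar_mxM.
Qed.

Lemma mx_scalar_central a X : abelian_algebra N -> N a -> mx_algebra N X ->
  a%:M * X = X * a%:M.
Proof.
move=> abN Na NX; apply/matrixP => i j.
rewrite -[_ * X]/(_ *m X) -[X * _]/(X *m _) mul_scalar_mx.
rewrite !mxE (bigD1 j) //= !mxE eqxx big1 ?addr0; first exact: abN.
by move=> k kj; rewrite mxE (negPf kj) mulr0.
Qed.

Lemma mx_projection_delta i : projections (mx_star star) (mx_algebra N) (delta_mx i i).
Proof.
split => [j k||].
- by rewrite mxE; case: andP => _; [exact: (subring1 hN) | exact: (subring0 hN)].
- apply/matrixP => j k; rewrite !mxE andbC.
  by case: andP => _; rewrite ?(star1 hstar) ?(star0 hstar).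
- by rewrite -[LHS]/(_ *m _) mul_delta_mx.
Qed.

End StarSubring.

Section Injectivity.
Variables (x : A) (P : 'M[A]_2).
Hypotheses (PP : P * P = P) (trP : P 0 0 + P 1 1 = 1).
Hypotheses (x_reg : GRing.lreg x) (omx_reg : GRing.lreg (1 - x)).
Hypothesis p_reg : GRing.lreg (P 0 0).
Let M := (1 - x)%:M * delta_mx 1 1 + x%:M * P.

Let mulE (X Y : 'M[A]_2) i j : (X * Y) i j = X i 0 * Y 0 j + X i 1 * Y 1 j.
Proof.
rewrite !mxE !big_ord_recl big_ord0 addr0; congr (_ + X i _ * Y _ j); exact: val_inj.
Qed.

Let scalarE a (X : 'M[A]_2) i j : (a%:M * X) i j = a * X i j.
Proof. by rewrite -[_ * X]/(_ *m X) mul_scalar_mx mxE. Qed.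

Let delta0E (Q : 'M[A]_2) j : (delta_mx 1 1 * Q : 'M[A]_2) 0 j = 0.
Proof. by rewrite mulE !mxE /= !mul0r addr0. Qed.

Let delta1E (Q : 'M[A]_2) j : (delta_mx 1 1 * Q : 'M[A]_2) 1 j = Q 1 j.
Proof. by rewrite mulE !mxE /= mul0r mul1r add0r. Qed.

Let mx2_eq0 (Q : 'M[A]_2) : (forall j, Q 0 j = 0) -> (forall j, Q 1 j = 0) -> Q = 0.
Proof.
move=> Q0 Q1; apply/matrixP => i j; rewrite [RHS]mxE.
case: i => [[|[|//]] lti].
  by rewrite (_ : Ordinal lti = 0) //; exact: val_inj.
by rewrite (_ : Ordinal lti = 1) //; exact: val_inj.
Qed.

(** If [M * Q = 0] and [W = P * Q], the upper row reads [x W_0 = 0]. Once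
    [W_0 = 0], the lower row of [P * W = W] reads [(1 - p) W_1 = W_1] for
    [p = P 0 0], so [W_1 = 0]. The lower row of [M * Q = 0] is now
    [(1 - x) Q_1 = 0], and the upper row of [W = 0] is [p Q_0 = 0]. *)
Lemma lreg_pencil : GRing.lreg M.
Proof.
apply: lreg_of_ker => Q MQ; pose W := P * Q.
have PW : P * W = W by rewrite /W mulrA PP.
have rowM i j : (1 - x) * (delta_mx 1 1 * Q : 'M[A]_2) i j + x * W i j = 0.
  have -> : 0 = (0 : 'M[A]_2) i j by rewrite mxE.
  have -> : 0 = (1 - x)%:M * (delta_mx 1 1 * Q) + x%:M * W.
    by rewrite -MQ mulrDl -!mulrA.
  by rewrite [RHS]mxE !scalarE.
have W0 j : W 0 j = 0.
  have := rowM 0 j; rewrite delta0E mulr0 add0r => xW.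
  by apply: x_reg; rewrite mulr0.
have W1 j : W 1 j = 0.
  apply: p_reg; rewrite mulr0 -(addrK (P 1 1) (P 0 0)) trP mulrBl mul1r.
  by rewrite -{1}PW mulE W0 mulr0 add0r subrr.
have Q1 j : Q 1 j = 0.
  have := rowM 1 j; rewrite delta1E W1 mulr0 addr0 => xQ.
  by apply: omx_reg; rewrite mulr0.
apply: mx2_eq0 => // j; apply: p_reg; rewrite mulr0.
by have := W0 j; rewrite mulE Q1 mulr0 addr0.
Qed.

(** The argument of [lreg_pencil] with the two rows exchanged, for [1 - P] and
    [1 - delta_mx 1 1]: the lower right corner of [1 - P] is again [P 0 0]. *)
Lemma lreg_compl_pencil : GRing.lreg (1 - M).
Proof.
apply: lreg_of_ker => Q MQ; pose W := (1 - P) * Q.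
have PW : (1 - P) * W = W.
  by rewrite /W mulrA mulrBl mul1r mulrBr mulr1 PP subrr subr0.
have rowM i j :
    (1 - x) * (Q i j - (delta_mx 1 1 * Q : 'M[A]_2) i j) + x * W i j = 0.
  have -> : 0 = (0 : 'M[A]_2) i j by rewrite mxE.
  have -> : Q i j - (delta_mx 1 1 * Q : 'M[A]_2) i j =
      ((1 - delta_mx 1 1) * Q : 'M[A]_2) i j.
    by rewrite mulrBl mul1r !mxE.
  have ME : 1 - M = (1 - x)%:M * (1 - delta_mx 1 1) + x%:M * (1 - P).
    rewrite /M !mulrBr !mulr1 raddfB /= opprD !addrA; congr (_ - _).
    by rewrite addrAC subrK.
  have -> : 0 = (1 - x)%:M * ((1 - delta_mx 1 1) * Q) + x%:M * W.
    by rewrite -MQ ME mulrDl -!mulrA.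
  by rewrite [RHS]mxE !scalarE.
have P11 : 1 - P 1 1 = P 0 0 by rewrite -trP addrK.
have W1 j : W 1 j = 0.
  have := rowM 1 j; rewrite delta1E subrr mulr0 add0r => xW.
  by apply: x_reg; rewrite mulr0.
have W0 j : W 0 j = 0.
  apply: p_reg; rewrite mulr0; have := mulE (1 - P) W 0 j.
  have -> : (1 - P) 0 0 = 1 - P 0 0 by rewrite !mxE.
  rewrite PW W1 mulr0 addr0 mulrBl mul1r => /eqP.
  by rewrite -subr_eq0 subKr => /eqP.
have Q0 j : Q 0 j = 0.
  have := rowM 0 j; rewrite delta0E W0 mulr0 addr0 subr0 => xQ.
  by apply: omx_reg; rewrite mulr0.
apply: mx2_eq0 => // j; apply: p_reg; rewrite mulr0.
have := W1 j; rewrite mulE Q0 mulr0 add0r.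
by have -> : (1 - P) 1 1 = P 0 0 by rewrite !mxE /= P11.
Qed.

End Injectivity.
End Matrices.

(** * Strict elements of a von Neumann algebra, and the theorem *)

Section VonNeumannStrict.
Variables (R : realType) (H : completeNormedModType R[i]).
Variable dot : {dot H for @Num.conj R[i]}.
Hypothesis hdot : norm_of_dot dot.
Variables (M0 : set (bop H)) (hM0 : von_neumann_algebra dot M0).
Local Notation adj := (adjoint dot).

Lemma adjoint_proper_involution : proper_involution adj.
Proof.
split; [exact: adjointB | exact: adjointM | exact: adjointK |].
exact: adjoint_proper.
Qed.

Lemma von_neumann_star_subring : star_subring adj M0.
Proof.
split; last exact: hM0.1.
- by rewrite -hM0.2 => b _; rewrite mul1r mulr1.
- rewrite -hM0.2 => a b ha hb c hc.
  by rewrite mulrBl mulrBr (ha c hc) (hb c hc).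
- rewrite -hM0.2 => a b ha hb c hc.
  by rewrite -mulrA (hb c hc) !mulrA (ha c hc).
Qed.

Lemma lreg_of_no_kernel_projection a : M0 a ->
  (forall e, projections adj M0 e -> a * e = 0 -> e = 0) -> GRing.lreg a.
Proof.
move=> Ma no_e; have [e [he ae efix]] := kernel_projection hdot hM0 Ma.
apply: lreg_of_ker => b ab; apply: bopP => x.
rewrite -(efix (b x)); first by rewrite (no_e e he ae).
by have := congr1 (fun c : bop H => c x) ab.
Qed.

(** This is where the von Neumann algebra hypothesis enters: strictness speaks
    of projections in the algebra, and the projections onto the kernels of [a]
    and [1 - a] belong to it. *)
Lemma strict_lreg a : strict adj M0 a -> GRing.lreg a /\ GRing.lreg (1 - a).
Proof.
move=> sa; have hN := von_neumann_star_subring.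
have hP := strict_no_projection adjoint_proper_involution hN sa.
have Ma : M0 a by case: sa => -[].
split; apply: lreg_of_no_kernel_projection => //.
- by move=> e /hP[].
- by apply: (subringB hN) => //; exact: (subring1 hN).
- move=> e /hP[_ he]; rewrite mulrBl mul1r => /eqP.
  by rewrite subr_eq0 eq_sym => /eqP.
Qed.

End VonNeumannStrict.

Theorem theorem1p3 (R : realType) (H : completeNormedModType R[i])
    (dot : {dot H for @Num.conj R[i]}) (hdot : norm_of_dot dot)
    (M0 : set (bop H)) (hM0 : von_neumann_algebra dot M0)
    (abM0 : abelian_algebra M0)
    (A B : 'M[bop H]_2)
    (hA : unit_interval (mx_star (adjoint dot)) (mx_algebra M0) A)
    (hB : unit_interval (mx_star (adjoint dot)) (mx_algebra M0) B)
    (x0 : bop H) (hx0 : strict (adjoint dot) M0 x0)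
    (P : 'M[bop H]_2) (hP : strict_projection (adjoint dot) M0 P)
    (eqA : A = (1 - x0)%:M * delta_mx 1 1 + x0%:M * P)
    (eqB : B = (1 - x0)%:M * delta_mx 1 1 + x0%:M * (1 - P)) :
  [/\ strict (mx_star (adjoint dot)) (mx_algebra M0) A,
      strict (mx_star (adjoint dot)) (mx_algebra M0) B &
      absolutely_compatible (mx_star (adjoint dot)) (mx_algebra M0) A B].
Proof.
have hS := adjoint_proper_involution hdot.
have hN := von_neumann_star_subring hM0.
have hMS := mx_star_proper_involution hS.
have hMN := mx_algebra_star_subring hN.
case: hP => projP sP trP.
have projP' := projection_compl hMS hMN projP.
have [[_ _ PP] [_ _ PP']] := (projP, projP').
have [x_reg omx_reg] := strict_lreg hdot hM0 hx0.
have [p_reg omp_reg] := strict_lreg hdot hM0 sP.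
have P'00 : (1 - P) 0 0 = 1 - P 0 0 by rewrite !mxE.
have trP' : (1 - P) 0 0 + (1 - P) 1 1 = 1.
  have -> : (1 - P) 1 1 = P 0 0 by rewrite !mxE /= -trP addrK.
  by rewrite P'00 subrK.
have p'_reg : GRing.lreg ((1 - P) 0 0) by rewrite P'00.
split.
- apply: (strict_of_lreg hMS hMN hA); rewrite eqA.
  + exact: lreg_pencil.
  + exact: lreg_compl_pencil.
- apply: (strict_of_lreg hMS hMN hB); rewrite eqB.
  + exact: lreg_pencil.
  + exact: lreg_compl_pencil.
split => //.
have [[Mx x_pos omx_pos] _ _] := hx0.
rewrite /le_in subr0 in x_pos.
have Momx : M0 (1 - x0) by apply: (subringB hN) => //; exact: (subring1 hN).
have absE a E : M0 a -> positive (adjoint dot) M0 a ->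
    projections (mx_star (adjoint dot)) (mx_algebra M0) E ->
  abs_val (mx_star (adjoint dot)) (mx_algebra M0) (a%:M * (1 - E - E)) = a%:M.
  move=> Ma a_pos hE; have [NE E_sa EE] := projection_reflection hMS hMN hE.
  apply: (abs_val_central_mul_symmetry hMS hMN
            (mx_positive_scalar hS hN a_pos) _ NE) => //.
  by move=> Z NZ; exact: (mx_scalar_central abM0 Ma NZ).
have -> : A - B = x0%:M * (1 - (1 - P) - (1 - P)).
  by rewrite eqA eqB opprD addrACA subrr add0r -mulrBr subKr.
have -> : 1 - A - B = (1 - x0)%:M * (1 - delta_mx 1 1 - delta_mx 1 1).
  have AB : A + B =
      (1 - x0)%:M * delta_mx 1 1 + (1 - x0)%:M * delta_mx 1 1 + x0%:M.
    by rewrite eqA eqB addrACA -(mulrDr x0%:M) [P + _]addrC subrK mulr1.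
  rewrite -addrA -opprD AB !mulrBr mulr1 [in X in X - _ - _]raddfB /=.
  by rewrite -!addrA -!opprD [x0%:M + _]addrC addrA.
rewrite !absE //; last exact: (mx_projection_delta hS hN).
by rewrite raddfB /= addrC subrK.
Qed.
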